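(* Let $d, w \in \mathbb{N}$ with $d > 1$ and $0 \leq w < 2^{d-1}$. Let $s = (s_0,\dotsc,s_{n-1})$ ($n \ge 0$) and $t = (t_0,\dotsc,t_{m-1})$ ($m \ge 1$) be Boolean input variables with arrival times in $\mathbb{N}$ such that $W(s) = w$ and \[ W(t) \leq 1.9 \cdot \frac{2^{d-1} - w}{d \log_2 (d)}. \] Then there is a Boolean circuit over $\{\land,\lor\}$ realizing $f(s, t)$ with delay at most $d$.
   Context: For Boolean variables $t = (t_0, \dotsc, t_{m-1})$ with $m \geq 1$, define recursively $g(t) = g^*(t) = t_0$ if $m=1$, and for $m>1$, $g(t) = t_0 \land g^*((t_1, \dotsc, t_{m-1}))$, $g^*(t) = t_0 \lor g((t_1, \dotsc, t_{m-1}))$. For $s = (s_0,\dotsc,s_{n-1})$ (possibly empty), $f(s,t) = s_0 \land \dotsb \land s_{n-1} \land g(t)$. A Boolean circuit over $\{\land,\lor\}$ is a directed acyclic graph whose indegree-0 nodes (inputs) are labeled by Boolean variables, with a unique outdegree-0 node (output) of indegree 1, and all other nodes are gates of indegree exactly 2 labeled \textsc{And} or \textsc{Or}; it realizes a Boolean function if its output computes that function for all input values. Each input variable $x$ has an arrival time $a(x) \in \mathbb{N}$; the delay of input $x$ is $a(x)$ plus the maximum number of gates on any directed path starting at $x$, and the delay of the circuit is the maximum delay over its inputs. The weight of an input is $W(x) = 2^{a(x)}$, and the weight of a tuple of inputs is the sum of the weights of its entries (empty tuple: $0$). *)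

(* Defs.v *)
From HB Require Import structures.
From mathcomp Require Import all_boot all_order all_algebra.
From mathcomp Require Import reals exp.
Set Implicit Arguments.
Unset Strict Implicit.
Unset Printing Implicit Defensive.
Import Order.TTheory GRing.Theory Num.Theory.

(* [and_or_path] is the function g and [or_and_path] its dual g^*. Both are
   meant for nonempty sequences; their value on [::] is never used. *)
Fixpoint and_or_path (t : seq bool) : bool :=
  match t with
  | [::] => true
  | [:: t0] => t0
  | t0 :: t' => t0 && or_and_path t'
  end
with or_and_path (t : seq bool) : bool :=
  match t with
  | [::] => false
  | [:: t0] => t0
  | t0 :: t' => t0 || and_or_path t'
  end.

Definition extended_and_or_path (s t : seq bool) : bool :=
  all id s && and_or_path t.

Inductive node_label (V : Type) : Type :=
  | Input of V
  | And
  | Or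
  | Output.
Arguments Input {V} _.
Arguments And {V}.
Arguments Or {V}.
Arguments Output {V}.

Definition arity (V : Type) (l : node_label V) : nat :=
  match l with Input _ => 0 | And | Or => 2 | Output => 1 end.

Definition is_input (V : Type) (l : node_label V) : bool :=
  if l is Input _ then true else false.

Definition is_gate (V : Type) (l : node_label V) : bool :=
  match l with And | Or => true | _ => false end.

(* A variable labels at most one input node ([label_inj]), so that an input
   node may be identified with its variable. Edges form a relation, hence there
   are no parallel edges and the two predecessors of a gate are distinct. *)
Record circuit (V : Type) : Type := Circuit {
  node : finType;
  edge : rel node;
  label : node -> node_label V;
  output : node;
  edge_acyclic : forall p : seq node, cycle edge p -> p = [::];
  indegE : forall v, #|[set u | edge u v]| = arity (label v);
  outdeg0E : forall v, (#|[set u | edge v u]| == 0) = (v == output);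
  label_output : forall v, label v = Output <-> v = output;
  label_inj : forall u v x, label u = Input x -> label v = Input x -> u = v
}.

(* [computes C x v b]: when the variables take the values [x], node [v] of [C]
   takes the value [b]. *)
Inductive computes (V : Type) (C : circuit V) (x : V -> bool) :
    node C -> bool -> Prop :=
  | computes_input v i :
      label v = Input i -> computes x v (x i)
  | computes_and v u1 u2 b1 b2 :
      label v = And -> u1 != u2 -> edge u1 v -> edge u2 v ->
      computes x u1 b1 -> computes x u2 b2 -> computes x v (b1 && b2)
  | computes_or v u1 u2 b1 b2 :
      label v = Or -> u1 != u2 -> edge u1 v -> edge u2 v ->
      computes x u1 b1 -> computes x u2 b2 -> computes x v (b1 || b2)
  | computes_output v u b :
      label v = Output -> edge u v -> computes x u b -> computes x v b.

Definition realizes (V : Type) (C : circuit V) (F : (V -> bool) -> bool) :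
    Prop :=
  forall x : V -> bool, computes x (output C) (F x).

(* The directed paths starting at [v] are the sequences [v :: p] with
   [path (@edge V C) v p]; as the graph is acyclic their nodes are pairwise
   distinct, so [size p < #|node C|]. *)
Definition max_gates_from (V : Type) (C : circuit V) (v : node C) : nat :=
  \max_(k < #|node C|) \max_(p : k.-tuple (node C) | path (@edge V C) v p)
    count (fun u => is_gate (label u)) (v :: p).

Definition input_delay (V : Type) (C : circuit V) (a : V -> nat)
    (v : node C) : nat :=
  if label v is Input x then a x + max_gates_from v else 0.

Definition delay (V : Type) (C : circuit V) (a : V -> nat) : nat :=
  \max_(v : node C | is_input (label v)) input_delay a v.

Definition weight (V : Type) (a : V -> nat) (s : seq V) : nat :=
  \sum_(x <- s) 2 ^ a x.

Definition log2 (R : realType) (x : R) : R := (ln x / ln 2)%R.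

(* Main.v *)
Require Import Defs.
From HB Require Import structures.
From mathcomp Require Import all_boot all_order all_algebra.
From mathcomp Require Import zify lra.
From mathcomp Require Import reals exp.
Import Order.TTheory GRing.Theory Num.Theory.

(* By induction on d, f(s, t) has delay at most d as soon as
   d W(u) + W(s) + W(x) + W(y) <= 2^(d-1), where x, y are the last two entries
   of t and u is the rest. For the step, let t1 be the longest prefix of odd
   length for which f(s, t1) fits into delay d-1, and use
     f(s, t1 ++ t2) = f(s, t1) /\ f*(odd entries of t1, t2).
   As t1 cannot be prolonged by the next two entries, W(t1) is so large that the
   second factor fits into delay d-1 as well. For d >= 4 the hypothesis gives
   d W(t) <= 2^(d-1) - w because log2 d >= 2 > 1.9; for d = 2, 3 it forces
   W(t) = 1. *)

Set Implicit Arguments.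
Unset Strict Implicit.
Unset Printing Implicit Defensive.

(** * Alternating paths and their splitting into two halves *)

(* The dual connectives are handled together: [true] stands for "and". *)
Definition bop (b x y : bool) : bool := if b then x && y else x || y.

Definition bigbop (b : bool) (s : seq bool) : bool :=
  if b then all id s else has id s.

Lemma bigbop_cons b x s : bigbop b (x :: s) = bop b x (bigbop b s).
Proof. by case: b. Qed.

Lemma bigbop_seq1 b x : bigbop b [:: x] = x.
Proof. by case: b; rewrite /= ?andbT ?orbF. Qed.

Lemma bigbop_cat b s1 s2 :
  bigbop b (s1 ++ s2) = bop b (bigbop b s1) (bigbop b s2).
Proof. by case: b => /=; rewrite ?all_cat ?has_cat. Qed.

Lemma bigbop_perm b s1 s2 : perm_eq s1 s2 -> bigbop b s1 = bigbop b s2.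
Proof. by case: b => /= /perm_mem e; [exact: eq_all_r | exact: eq_has_r]. Qed.

(* The value at [::] is the unit of the connective that precedes it, so that
   the recursion needs no separate case for singletons. *)
Fixpoint altpath (b : bool) (t : seq bool) : bool :=
  if t is x :: t' then bop b x (altpath (~~ b) t') else ~~ b.

Lemma altpathE t : t != [::] ->
  and_or_path t = altpath true t /\ or_and_path t = altpath false t.
Proof.
elim: t => [//|x [|y t] IH] _ /=; first by rewrite andbT orbF.
by have [/= -> ->] := IH isT.
Qed.

Fixpoint alternate (T : Type) (c : bool) (t : seq T) : seq T :=
  if t is x :: t' then
    if c then x :: alternate (~~ c) t' else alternate (~~ c) t'
  else [::].

Lemma map_alternate (T U : Type) (f : T -> U) c t :
  map f (alternate c t) = alternate c (map f t).
Proof. by elim: t c => [//|x t IH] [] /=; rewrite IH. Qed.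

(** Here [c] is the connective between [t1] and [t2]. Distributing over it the entries of [t1]
    followed by the dual connective pulls [c] to the top. The entries followed by [c] itself already
    constrain the first half and need not recur in the second. *)
Lemma altpath_cat b t1 t2 (c := ~~ (b (+) odd (size t1))) :
  altpath b (t1 ++ t2) =
  bop c (altpath b t1)
    (bop (~~ c) (bigbop (~~ c) (alternate (b (+) c) t1)) (altpath (~~ c) t2)).
Proof.
rewrite {}/c; elim: t1 b => [|x t1 IH] b /=.
  by case: b; rewrite /= ?andbT ?orbF.
rewrite IH /=.
case: b; case: (odd _) => /=; case: x => //=;
  by rewrite ?orbT ?andbF ?andbT ?orbF //= ?andbT ?orbT.
Qed.

Lemma altpath_cat_odd b t1 t2 : odd (size t1) ->
  altpath b (t1 ++ t2) =
  bop b (altpath b t1)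
    (bop (~~ b) (bigbop (~~ b) (alternate false t1)) (altpath (~~ b) t2)).
Proof. by move=> o; rewrite altpath_cat o addbT negbK addbb. Qed.

Lemma altpath_cat_even b t1 t2 : ~~ odd (size t1) ->
  altpath b (t1 ++ t2) =
  bop (~~ b) (altpath b t1)
    (bop b (bigbop b (alternate true t1)) (altpath b t2)).
Proof.
by move=> /negbTE o; rewrite altpath_cat o addbF negbK; case: b.
Qed.

(** * Formulas with arrival times and Kraft's inequality *)

Section Formulas.
Variables (V : eqType) (a : V -> nat).

Inductive formula := Leaf of V | Node of bool & formula & formula.

Fixpoint formula_eqb (f g : formula) : bool :=
  match f, g with
  | Leaf x, Leaf y => x == y
  | Node b f1 f2, Node c g1 g2 =>
      [&& b == c, formula_eqb f1 g1 & formula_eqb f2 g2]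
  | _, _ => false
  end.

Lemma formula_eqP : Equality.axiom formula_eqb.
Proof.
elim=> [x|b f1 IH1 f2 IH2] [y|c g1 g2] /=; try by constructor.
  by apply: (iffP eqP) => [->|[->]].
apply: (iffP and3P) => [[/eqP-> e1 e2]|[-> e1 e2]].
  by rewrite (elimT (IH1 _) e1) (elimT (IH2 _) e2).
by split; [exact: eqxx | exact: introT (IH1 _) e1 | exact: introT (IH2 _) e2].
Qed.

HB.instance Definition _ := hasDecEq.Build formula formula_eqP.

Fixpoint eval (v : V -> bool) (f : formula) : bool :=
  match f with
  | Leaf x => v x
  | Node b f1 f2 => bop b (eval v f1) (eval v f2)
  end.

Fixpoint fdelay (f : formula) : nat :=
  match f with
  | Leaf x => a x
  | Node _ f1 f2 => (maxn (fdelay f1) (fdelay f2)).+1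
  end.

(* The two predecessors of a gate of a circuit are distinct. *)
Fixpoint irredundant (f : formula) : bool :=
  match f with
  | Leaf _ => true
  | Node _ f1 f2 => [&& f1 != f2, irredundant f1 & irredundant f2]
  end.

Definition feasible (d : nat) (phi : (V -> bool) -> bool) : Prop :=
  exists f, [/\ irredundant f, fdelay f <= d & forall v, eval v f = phi v].

Lemma feasible_ext d phi psi :
  phi =1 psi -> feasible d phi -> feasible d psi.
Proof. by move=> e [f [i l h]]; exists f; split=> // v; rewrite h e. Qed.

Lemma feasibleW d1 d2 phi : d1 <= d2 -> feasible d1 phi -> feasible d2 phi.
Proof. by move=> l [f [i l1 h]]; exists f; split=> //; exact: leq_trans l. Qed.

Lemma feasible_bop b d phi psi : feasible d phi -> feasible d psi ->
  feasible d.+1 (fun v => bop b (phi v) (psi v)).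
Proof.
move=> [f [fi fl fh]] [g [gi gl gh]]; have [e|ne] := eqVneq f g.
  (* Joining [f] to itself would break irredundancy; by idempotence one copy suffices. *)
  exists f; split=> // [|v]; first exact: leqW.
  by rewrite -fh -gh -e; case: b; rewrite /= ?andbb ?orbb.
exists (Node b f g); split=> [||v] /=; first by rewrite ne fi gi.
  by rewrite ltnS geq_max fl gl.
by rewrite fh gh.
Qed.

Lemma weight_nil : weight a [::] = 0.
Proof. exact: big_nil. Qed.

Lemma weight_cons x s : weight a (x :: s) = 2 ^ a x + weight a s.
Proof. exact: big_cons. Qed.

Lemma weight_cat s1 s2 : weight a (s1 ++ s2) = weight a s1 + weight a s2.
Proof. exact: big_cat. Qed.

Lemma size_le_weight s : size s <= weight a s.
Proof.
elim: s => [//|x s IH]; rewrite weight_cons /= -add1n leq_add ?expn_gt0 //.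
Qed.

Lemma weight_alternate c t : weight a (alternate c t) <= weight a t.
Proof.
elim: t c => [|x t IH] [] //=; rewrite !weight_cons; have := IH true;
  have := IH false => /=; lia.
Qed.

(* In an order of decreasing weights every partial sum is a multiple of the
   weights that follow. *)
Lemma exact_prefix_weight (l : seq V) N :
  sorted (fun x y => a y <= a x) l ->
  (forall x, ohead l = Some x -> 2 ^ a x %| N) -> N <= weight a l ->
  exists k, weight a (take k l) = N.
Proof.
elim: l N => [|x l IH] N.
  by rewrite weight_nil leqn0 => _ _ /eqP->; exists 0.
move=> srt dv; have [->|N0] := posnP N; first by exists 0; rewrite take0 weight_nil.
have dx : 2 ^ a x %| N by exact: dv.
rewrite weight_cons => le.
have [||k hk] := IH (N - 2 ^ a x) (path_sorted srt); last 1 first.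
- by exists k.+1; rewrite /= weight_cons hk subnKC // dvdn_leq.
- case: l srt {IH dv le} => [|y l] //= /andP[yx _] _ [<-].
  by rewrite dvdn_sub // ?dvdn_exp2l // (dvdn_trans _ dx) ?dvdn_exp2l.
- by lia.
Qed.

(* Kraft's inequality for one connective. *)
Lemma feasible_bigbop b d (l : seq V) : l != [::] -> weight a l <= 2 ^ d ->
  feasible d (fun v => bigbop b (map v l)).
Proof.
elim: d l => [|d IH] l l0 wl.
  case: l l0 wl => [//|x [|y l]] _; last first.
    by move/(leq_trans (size_le_weight _)).
  rewrite weight_cons weight_nil addn0 leq_exp2l // => ax.
  exists (Leaf x); split=> // v.
  exact/esym/bigbop_seq1.
pose r x y := a y <= a x; pose l' := sort r l.
have pl : perm_eq l' l by rewrite perm_sort.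
have wl' : weight a l' = weight a l by exact: perm_big.
apply: (@feasible_ext _ (fun v => bigbop b (map v l'))).
  by move=> v; apply/bigbop_perm/perm_map.
have l'0 : l' != [::] by rewrite -size_eq0 (perm_size pl) size_eq0.
have srt : sorted r l' by apply: sort_sorted => x y; exact: leq_total.
rewrite -{}wl' in wl; move: l'0 srt wl; clearbody l'; clear l l0 pl.
move: l' => l l0 srt wl.
have [lt|gt] := leqP (weight a l) (2 ^ d); first exact: feasibleW (IH l l0 lt).
case: l l0 srt wl gt => [//|x [|y l]] _ srt.
  rewrite weight_cons weight_nil addn0 leq_exp2l // => ax _.
  exists (Leaf x); split=> // v.
  exact/esym/bigbop_seq1.
set l2 := x :: y :: l => wl gt.
(* The presence of [y] keeps [2 ^ a x] strictly below [2 ^ d.+1], so it divides [2 ^ d]. A prefix of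
   weight exactly [2 ^ d] then exists, and at most [2 ^ d] is left for the other half. *)
have ax : a x <= d.
  have : 2 ^ a x < 2 ^ d.+1.
    apply: leq_trans wl; rewrite !weight_cons; have := expn_gt0 2 (a y); lia.
  by rewrite ltn_exp2l.
have [z||k hk] := @exact_prefix_weight l2 (2 ^ d) srt.
- by move=> [<-]; rewrite dvdn_exp2l.
- exact: ltnW.
have w2 : weight a l2 = 2 ^ d + weight a (drop k l2).
  by rewrite -{1}(cat_take_drop k l2) weight_cat hk.
apply: (@feasible_ext _ (fun v => bop b (bigbop b (map v (take k l2)))
   (bigbop b (map v (drop k l2))))).
  by move=> v; rewrite -bigbop_cat -map_cat cat_take_drop.
have p2 := expn_gt0 2 d.
apply: feasible_bop; apply: IH; rewrite ?hk //.
- by apply: contraTneq p2 => e; rewrite -hk e weight_nil.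
- by apply: contraTneq gt => e; rewrite w2 e weight_nil addn0 ltnn.
- by move: wl; rewrite w2 expnS; lia.
Qed.

Definition extpath b (s t : seq V) (v : V -> bool) : bool :=
  bop b (bigbop b (map v s)) (altpath b (map v t)).

(* The last two entries of [t] are counted with factor 1 only. Thanks to this a
   prefix that fills its share of the budget may be chosen greedily, however
   heavy the two entries are which do not fit any more. *)
Definition cost (p : nat) (t : seq V) : nat :=
  p * weight a (take (size t - 2) t) + weight a (drop (size t - 2) t).

Lemma cost_cat2 p u x y :
  cost p (u ++ [:: x; y]) = p * weight a u + (2 ^ a x + 2 ^ a y).
Proof.
rewrite /cost size_cat addnK take_size_cat // drop_size_cat //.
by rewrite !weight_cons weight_nil addn0.
Qed.

Lemma cost_seq1 p x : cost p [:: x] = 2 ^ a x.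
Proof. by rewrite /cost /= weight_cons weight_nil muln0 addn0. Qed.

Lemma cost_le_mul p t : 0 < p -> cost p t <= p * weight a t.
Proof.
move=> p0; rewrite /cost -{5}(cat_take_drop (size t - 2) t) weight_cat mulnDr.
by rewrite leq_add2l leq_pmull.
Qed.

Lemma extpath_split_odd b d s t1 t2 : odd (size t1) ->
  feasible d (extpath b s t1) ->
  feasible d (extpath (~~ b) (alternate false t1) t2) ->
  feasible d.+1 (extpath b s (t1 ++ t2)).
Proof.
move=> o f1 f2; apply: feasible_ext (feasible_bop b f1 f2) => v.
rewrite /extpath map_cat altpath_cat_odd ?size_map // map_alternate.
by case: b {f1 f2}; rewrite /bop ?andbA ?orbA.
Qed.

(** The outer connective is now [~~ b], over which [s] has to be distributed; unlike in the odd
    split, its weight is paid in both halves. *)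
Lemma extpath_split_even b d s t1 t2 : ~~ odd (size t1) ->
  feasible d (extpath b s t1) ->
  feasible d (extpath b (s ++ alternate true t1) t2) ->
  feasible d.+1 (extpath b s (t1 ++ t2)).
Proof.
move=> o f1 f2; apply: feasible_ext (feasible_bop (~~ b) f1 f2) => v.
rewrite /extpath !map_cat altpath_cat_even ?size_map // bigbop_cat map_alternate.
by case: b {f1 f2}; case: (bigbop _ (map v s)); rewrite //= ?orbF ?andbT.
Qed.

(** Up to two entries involve a single connective, so Kraft's inequality applies to [s ++ t]. *)
Lemma feasible_extpath_le2 b d s t : 0 < size t <= 2 ->
  weight a s + weight a t <= 2 ^ d -> feasible d (extpath b s t).
Proof.
move=> st w; apply: (@feasible_ext _ (fun v => bigbop b (map v (s ++ t)))).
  move=> v; rewrite /extpath map_cat bigbop_cat.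
  case: t st {w} => [//|x [|y [|//]]] _ /=; case: b => /=; by rewrite ?andbT ?orbF.
apply: feasible_bigbop; last by rewrite weight_cat.
by rewrite -size_eq0 size_cat; lia.
Qed.

(** The induction claim, made for both values of [b] because an odd split hands the dual problem to
    its second half. *)
Definition feasible_within (d : nat) : Prop := forall b s t, t != [::] ->
  cost d.+1 t + weight a s <= 2 ^ d -> feasible d.+1 (extpath b s t).

(** The prefix [t1] absorbs two entries of [r] at a time, which keeps its length odd, until it no
    longer fits into half the budget. *)
Lemma feasible_greedy d b s t1 r : feasible_within d -> odd (size t1) ->
  cost d.+1 t1 + weight a s <= 2 ^ d ->
  cost d.+2 (t1 ++ r) + weight a s <= 2 ^ d.+1 ->
  feasible d.+2 (extpath b s (t1 ++ r)).
Proof.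
move=> IH; elim: (size r).+1 {-2}r t1 (leqnn (size r).+1) => [//|n IHn] {}r t1 sr.
move=> o c1 c; have t10 : t1 != [::] by case: t1 o {c1 c}.
have f1 := IH b _ _ t10 c1.
have wo := weight_alternate false t1.
have E : 2 ^ d.+1 = 2 * 2 ^ d by rewrite expnS.
case: r sr c => [|x [|y r]] sr c.
- by rewrite cats0; exact: feasibleW f1.
- apply: extpath_split_odd => //; apply: feasible_extpath_le2 => //.
  case/lastP: t1 o t10 {c1 f1 IHn} c wo => [//|u z] _ _.
  rewrite -cats1 -catA cost_cat2 !weight_cat !weight_cons weight_nil; nia.
have [c2|c2] := leqP (cost d.+1 (t1 ++ [:: x; y]) + weight a s) (2 ^ d).
  rewrite -cat1s -(cat1s y) !catA -(catA t1); apply: IHn => //=.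
  - by move: sr; rewrite /=; lia.
  - by rewrite size_cat oddD o.
  - by rewrite -!catA.
rewrite cost_cat2 in c2.
case: r sr c => [|z r] sr c.
- apply: extpath_split_odd => //; apply: feasible_extpath_le2 => //.
  rewrite cost_cat2 in c; rewrite !weight_cons weight_nil; nia.
case: r sr c => [|z' r] sr c; last first.
  apply: extpath_split_odd => //; apply: IH => //.
  have [q [x' [y' eq]]] : exists q x' y', [:: z, z' & r] = q ++ [:: x'; y'].
    case/lastP: r {sr c} => [|r y']; first by exists [::], z, z'.
    case/lastP: r => [|r x']; first by exists [:: z], z', y'.
    by exists [:: z, z' & r], x', y'; rewrite -!cats1 -!catA.
  rewrite {}eq -!cat_cons in c *; rewrite catA cost_cat2 in c.
  (* Subtracting the failed inequality [c2] from [c] leaves [t1] with factor 1 and [x], [y] with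
     factor [d.+1], which is what the second half needs. With three entries left, [y] is discounted
     in both and would cancel; hence the separate case below. *)
  rewrite cost_cat2 !weight_cat !weight_cons in c *; nia.
(* What is left is [:: x; y; z], of which [y] and [z] are the two discounted
   entries: either the dual split before [y] works, or [y] and [z] are so light
   that x together with the odd entries of t1, and y, z fit into half the delay
   budget each. *)
have eq : t1 ++ [:: x; y; z] = (t1 ++ [:: x]) ++ [:: y; z] by rewrite -catA.
rewrite eq cost_cat2 weight_cat weight_cons weight_nil in c.
set w := weight a t1 in c c2 wo *.
have [c3|c3] := leqP (d.+1 * (w + 2 ^ a x) + weight a s) (2 ^ d).
  rewrite eq; apply: extpath_split_even.
  - by rewrite size_cat oddD o.
  - apply: IH; first by case: (t1).
    apply: leq_trans c3; rewrite leq_add2r.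
    apply: leq_trans (cost_le_mul _ _) _ => //.
    by rewrite weight_cat weight_cons weight_nil addn0.
  - apply: feasible_extpath_le2 => //.
    have := weight_alternate true (t1 ++ [:: x]).
    rewrite !weight_cat !weight_cons weight_nil -/w; nia.
(* Subtracting [c3] from [c] bounds [w + 2 ^ a x + 2 ^ a y + 2 ^ a z] by [2 ^ d]. *)
apply: extpath_split_odd => //.
have f2 : feasible d (fun v => bigbop (~~ b) (map v (x :: alternate false t1))).
  apply: feasible_bigbop => //; rewrite weight_cons; nia.
have f3 : feasible d (fun v => bigbop b (map v [:: y; z])).
  apply: feasible_bigbop => //; rewrite !weight_cons weight_nil; nia.
apply: feasible_ext (feasible_bop (~~ b) f2 f3) => v; rewrite /extpath /=.
rewrite !bigbop_cons; case: (b); case: (v x) => //=;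
  by rewrite ?negbK ?andbT ?orbF ?orbT ?andbF.
Qed.

Lemma feasible_withinP d : feasible_within d.
Proof.
elim: d => [|d IH] b s [//|x t] _ c.
  have lt : weight a (x :: t) + weight a s <= 1.
    move: c; rewrite /cost mul1n -weight_cat cat_take_drop; lia.
  have st := size_le_weight (x :: t).
  apply: feasible_extpath_le2; rewrite /= in st *; lia.
have E : 2 ^ d.+1 = 2 * 2 ^ d by rewrite expnS.
have [c1|c1] := leqP (2 ^ a x + weight a s) (2 ^ d).
  by apply: (@feasible_greedy d b s [:: x] t) => //; rewrite cost_seq1.
case: t c => [|y t] c.
  apply: feasible_extpath_le2 => //; rewrite weight_cons weight_nil.
  by rewrite cost_seq1 in c; rewrite expnS; lia.
(* Since [x] and [s] alone exceed half the budget, the remaining entries cost less than the other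
   half. Splitting off [x] passes nothing on, as [alternate false [:: x]] is empty. *)
apply: (@extpath_split_odd b d.+1 s [:: x]) => //.
  apply: feasible_extpath_le2 => //; rewrite weight_cons weight_nil.
  move: c; rewrite /cost /= subSS.
  case: (size t) => [|k] /=; rewrite ?subn0 ?subSS !weight_cons ?weight_nil; nia.
apply: IH => //=; rewrite weight_nil.
move: c; case/lastP: t => [|t z].
  by rewrite cost_seq1 -(cat0s [:: x; y]) cost_cat2 weight_nil; nia.
case/lastP: t => [|t z'].
  by rewrite -(cat0s (y :: _)) -(cat1s x) !cost_cat2 !weight_cons weight_nil; nia.
rewrite -!cats1 -!catA /= -!cat_cons !cost_cat2 !weight_cons; nia.
Qed.

(** * The circuit of an irredundant formula *)

Fixpoint subformulas (f : formula) : seq formula :=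
  f :: if f is Node _ f1 f2 then subformulas f1 ++ subformulas f2 else [::].

Definition child (f g : formula) : bool :=
  if g is Node _ g1 g2 then f \in [:: g1; g2] else false.

Lemma subformulas_self f : f \in subformulas f.
Proof. by case: f => *; exact: mem_head. Qed.

Lemma subformulas_child f g h :
  g \in subformulas h -> child f g -> f \in subformulas h.
Proof.
elim: h => [x|b h1 IH1 h2 IH2].
  by rewrite inE => /eqP->.
rewrite inE mem_cat => /or3P[/eqP->|g1|g2] c.
- move: c; rewrite /= !inE mem_cat.
  by case/orP => /eqP->; rewrite subformulas_self !orbT.
- by rewrite inE mem_cat (IH1 g1 c) orbT.
- by rewrite inE mem_cat (IH2 g2 c) !orbT.
Qed.

Lemma subformulas_parent f h : f \in subformulas h ->
  f = h \/ exists2 g, g \in subformulas h & child f g.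
Proof.
elim: h => [x|b h1 IH1 h2 IH2]; first by rewrite inE => /eqP->; left.
rewrite inE mem_cat => /or3P[/eqP->|/IH1 H|/IH2 H]; first by left.
- right; case: H => [->|[g gh c]].
    by exists (Node b h1 h2); rewrite ?subformulas_self //= mem_head.
  by exists g; rewrite // inE mem_cat gh orbT.
- right; case: H => [->|[g gh c]].
    by exists (Node b h1 h2); rewrite ?subformulas_self //= !inE eqxx orbT.
  by exists g; rewrite // inE mem_cat gh !orbT.
Qed.

Lemma fdelay_child f g : child f g -> fdelay f < fdelay g.
Proof.
by case: g => [//|b g1 g2] /=; rewrite !inE ltnS leq_max => /orP[]/eqP->;
  rewrite leqnn ?orbT.
Qed.

Lemma fdelay_subformulas f h : f \in subformulas h -> fdelay f <= fdelay h.
Proof.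
elim: h => [x|b h1 IH1 h2 IH2]; first by rewrite inE => /eqP->.
rewrite inE mem_cat => /or3P[/eqP-> //|/IH1 H|/IH2 H];
  by rewrite leqW // leq_max H ?orbT.
Qed.

Lemma irredundant_subformulas f h :
  f \in subformulas h -> irredundant h -> irredundant f.
Proof.
elim: h => [x|b h1 IH1 h2 IH2]; first by rewrite inE => /eqP->.
by rewrite inE mem_cat => /or3P[/eqP-> //|/IH1 H|/IH2 H] /= /and3P[_ ? ?]; exact: H.
Qed.

Section CircuitOfFormula.
Variables (F : formula) (irrF : irredundant F).

Let l := undup (subformulas F).

(* [None] is the output node; equal subformulas share one node. *)
Definition fnode : finType := option 'I_(size l).

Definition subf (i : 'I_(size l)) : formula := nth F l i.

Lemma subf_inj : injective subf.
Proof.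
move=> i j /eqP; rewrite nth_uniq ?undup_uniq // => /eqP; exact: val_inj.
Qed.

Lemma mem_subf i : subf i \in subformulas F.
Proof. by rewrite -mem_undup mem_nth. Qed.

Lemma subf_surj f : f \in subformulas F -> exists i, subf i = f.
Proof.
rewrite -mem_undup => fl; have lt : index f l < size l by rewrite index_mem.
by exists (Ordinal lt); rewrite /subf nth_index.
Qed.

Definition fedge : rel fnode := fun u v =>
  match u, v with
  | Some i, Some j => child (subf i) (subf j)
  | Some i, None => subf i == F
  | None, _ => false
  end.

Definition flabel (u : fnode) : node_label V :=
  if u is Some i then
    match subf i with
    | Leaf x => Input x
    | Node b _ _ => if b then And else Or
    end
  else Output.

(** A topological order: strict growth along edges excludes cycles. *)
Definition rank (u : fnode) : nat :=
  if u is Some i then fdelay (subf i) else (fdelay F).+1.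

Lemma fedge_rank u v : fedge u v -> rank u < rank v.
Proof.
case: u v => [i|] [j|] //=; first exact: fdelay_child.
by move=> /eqP->.
Qed.

Lemma fedge_acyclic p : cycle fedge p -> p = [::].
Proof.
case: p => [//|u p] /= h.
have : path (relpre rank ltn) u (rcons p u) by apply: sub_path h; exact: fedge_rank.
move/order_path_min => /(_ (fun _ _ _ => @ltn_trans _ _ _)) /allP /(_ u).
by rewrite mem_rcons mem_head /= ltnn => /(_ isT).
Qed.

Lemma fedge_pred j b f1 f2 : subf j = Node b f1 f2 ->
  exists i1 i2, [/\ subf i1 = f1, subf i2 = f2, i1 != i2 &
    [set u | fedge u (Some j)] = [set Some i1; Some i2]].
Proof.
move=> e; have m := mem_subf j.
have [|i1 e1] := @subf_surj f1.
  by apply: subformulas_child m _; rewrite e /= mem_head.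
have [|i2 e2] := @subf_surj f2.
  by apply: subformulas_child m _; rewrite e /= !inE eqxx orbT.
exists i1, i2; split=> //.
  have := irredundant_subformulas m irrF; rewrite e /= => /and3P[ne _ _].
  by apply: contraNneq ne => ei; rewrite -e1 -e2 ei.
apply/setP=> -[i|]; rewrite !inE //= e /= !inE -e1 -e2.
by rewrite !(inj_eq subf_inj).
Qed.

Lemma fedge_indegree v : #|[set u | fedge u v]| = arity (flabel v).
Proof.
case: v => [j|] /=.
  case e: (subf j) => [x|b f1 f2].
    by apply/eqP; rewrite cards_eq0; apply/eqP/setP=> -[i|]; rewrite !inE //= e.
  have [i1 [i2 [_ _ ne ->]]] := fedge_pred e.
  by rewrite cards2 (inj_eq Some_inj) ne; case: (b).
have [i e] := subf_surj (subformulas_self F).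
rewrite -(cards1 (Some i : fnode)); congr #|pred_of_set _|.
by apply/setP=> -[k|]; rewrite !inE //= -e (inj_eq subf_inj).
Qed.

Lemma fedge_outdegree v : (#|[set u | fedge v u]| == 0) = (v == None).
Proof.
rewrite cards_eq0; case: v => [i|]; last first.
  by rewrite eqxx; apply/eqP/setP => u; rewrite !inE.
apply/negbTE/set0Pn.
case: (subformulas_parent (mem_subf i)) => [e|[g /subf_surj[j <-] c]].
  by exists None; rewrite inE /= e.
by exists (Some j); rewrite inE.
Qed.

Lemma flabel_output v : flabel v = Output <-> v = None.
Proof. by case: v => [i|] //=; case: (subf i) => [x|[]]. Qed.

Lemma flabel_inj u v x : flabel u = Input x -> flabel v = Input x -> u = v.
Proof.
case: u v => [i|] [j|] //=.
case ei: (subf i) => [y|[] //]; case ej: (subf j) => [z|[] //] [yx] [zx].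
by congr Some; apply: subf_inj; rewrite ei ej yx zx.
Qed.

Definition fcircuit : circuit V :=
  Circuit fedge_acyclic fedge_indegree fedge_outdegree flabel_output flabel_inj.

Lemma fcircuit_computes v f i : subf i = f ->
  @computes V fcircuit v (Some i) (eval v f).
Proof.
elim: f i => [x|b f1 IH1 f2 IH2] i e.
  by apply: computes_input; rewrite /= e.
have [i1 [i2 [e1 e2 ne E]]] := fedge_pred e.
have E1 : fedge (Some i1) (Some i) by move/setP: E => /(_ (Some i1)); rewrite !inE eqxx.
have E2 : fedge (Some i2) (Some i).
  by move/setP: E => /(_ (Some i2)); rewrite !inE eqxx orbT.
case: b e {E} => e /=.
- apply: (@computes_and V fcircuit v (Some i) (Some i1) (Some i2)) => //=.
  + by rewrite e.
  + exact: IH1.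
  + exact: IH2.
- apply: (@computes_or V fcircuit v (Some i) (Some i1) (Some i2)) => //=.
  + by rewrite e.
  + exact: IH1.
  + exact: IH2.
Qed.

Lemma fcircuit_realizes : realizes fcircuit (fun v => eval v F).
Proof.
move=> v; have [i e] := subf_surj (subformulas_self F).
apply: (@computes_output V fcircuit v None (Some i)) => //=.
  by apply/eqP.
exact: fcircuit_computes.
Qed.

(** Every gate entered raises [fdelay] by at least one. The start node is not counted, being already
    included in [fdelay (subf i)]. *)
Lemma fcircuit_path_gates (i : 'I_(size l)) (p : seq fnode) :
  path fedge (Some i) p ->
  fdelay (subf i) + count (fun u => is_gate (flabel u)) p <= fdelay F.
Proof.
elim: p i => [|[j|] p IH] i /=.
- by move=> _; rewrite addn0 fdelay_subformulas ?mem_subf.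
- move=> /andP[/fdelay_child c /IH]; apply: leq_trans.
  by rewrite addnA leq_add2r (leq_trans _ c) // -addn1 leq_add2l leq_b1.
- by case: p {IH} => [|u p] /andP[/eqP-> //]; rewrite addn0.
Qed.

Lemma fcircuit_delay : delay fcircuit a <= fdelay F.
Proof.
apply/bigmax_leqP => -[i|//] _; rewrite /input_delay /=.
case e: (subf i) => [x|[]] //=.
rewrite -leq_subRL; last first.
  by have := fdelay_subformulas (mem_subf i); rewrite e.
apply/bigmax_leqP => k _; apply/bigmax_leqP => p /fcircuit_path_gates.
by rewrite /= e /= add0n => h; rewrite leq_subRL ?(leq_trans _ h) ?leq_addr.
Qed.

End CircuitOfFormula.

Lemma circuit_of_cost d s t : 0 < d -> t != [::] ->
  cost d t + weight a s <= 2 ^ (d - 1) ->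
  exists C : circuit V,
    realizes C (fun x => extended_and_or_path (map x s) (map x t)) /\
    delay C a <= d.
Proof.
case: d => [//|d] _ t0; rewrite subn1 /= => c.
have [F [irrF leF eF]] := feasible_withinP true t0 c.
exists (fcircuit irrF); split; last exact: leq_trans (fcircuit_delay irrF) leF.
move=> v; have -> : extended_and_or_path (map v s) (map v t) = eval v F.
  rewrite eF /extended_and_or_path (altpathE _).1 //.
  by case: (t) t0.
exact: fcircuit_realizes.
Qed.

End Formulas.

(** * Numerical bounds turning the weight hypothesis into the cost budget *)

Lemma log2_ge (R : realType) (p q n : nat) : (0 < n)%N -> (2 ^ p <= n ^ q)%N ->
  (p%:R <= q%:R * log2 (n%:R : R))%R.
Proof.
move=> n0 h; have l2 : (0 < ln (2 : R))%R by rewrite ln_gt0 // ltr1n.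
rewrite /log2 mulrA ler_pdivlMr //.
rewrite mulr_natl -lnXn ?ltr0n // mulr_natl -lnXn ?ltr0n //.
by rewrite ler_ln ?posrE ?exprn_gt0 ?ltr0n // -!natrX ler_nat.
Qed.

Lemma cost_le_of_weight (R : realType) (V : eqType) (a : V -> nat) (d w : nat)
    (t : seq V) : (1 < d)%N -> (w < 2 ^ (d - 1))%N -> t != [::] ->
  ((weight a t)%:R <=
     19 / 10 * ((2 ^+ (d - 1) - w%:R) / (d%:R * log2 (d%:R : R))))%R ->
  (cost a d t + w <= 2 ^ (d - 1))%N.
Proof.
move=> d1 wd t0 ht.
have d0 : (0 < d%:R :> R)%R by rewrite ltr0n ltnW.
have L1 : (1 <= log2 (d%:R : R))%R.
  by have := @log2_ge R 1 1 d (ltnW d1); rewrite expn1 mul1r; apply.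
have st := size_le_weight a t.
move: ht; rewrite mulrA ler_pdivlMr; last by rewrite mulr_gt0 // (lt_le_trans _ L1).
set W : R := ((weight a t)%:R)%R; set Y := (2 ^+ (d - 1) - w%:R)%R => ht.
have w0 : (0 <= w%:R :> R)%R by [].
have [d4|d4] := leqP 4 d.
  have L2 : (2 <= log2 (d%:R : R))%R.
    have := @log2_ge R 2 1 d (ltnW d1); rewrite mul1r; apply.
    by rewrite expn1.
  apply: leq_trans (leq_add (cost_le_mul _ _ (ltnW d1)) (leqnn w)) _.
  rewrite -(ler_nat R) natrD natrM natrX -/W -lerBrDr -/Y.
  have dW : (0 <= d%:R * W)%R by rewrite mulr_ge0 // ?ler0n.
  nra.
(* The bound is at most 1.9 * 2 / 2 for [d = 2], and at most 1.9 * 4 / 4.5 for [d = 3], where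
   [2 ^ 3 <= 3 ^ 2] gives log2 3 >= 3/2. *)
have wt : (weight a t < 2)%N.
  rewrite -(ltr_nat R) -/W.
  have W0 : (0 <= W)%R by [].
  have : (d == 2)%N || (d == 3)%N by lia.
  case/orP => /eqP E; move: ht; rewrite /Y E.
    rewrite E in L1; rewrite subn1 /= expr1; nra.
  have L3 : (3 <= 2 * log2 (3 : R))%R by exact: (@log2_ge R 3 2 3).
  rewrite subn1 /= expr2; nra.
(* Weight below 2 leaves a single entry, which is not multiplied by [d]; its weight 1 fits because
   [w < 2 ^ (d - 1)]. *)
have -> : cost a d t = weight a t.
  by case: (t) t0 st wt => [//|x [|y r]] _ /=; [rewrite cost_seq1 /weight big_seq1 | lia].
lia.
Qed.

Theorem theorem3p2 (R : realType) (V : eqType) (a : V -> nat) (d w n m : nat)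
    (s : n.-tuple V) (t : m.-tuple V)
    (hd : 1 < d) (hw : w < 2 ^ (d - 1)) (hm : 1 <= m)
    (hs : weight a s = w)
    (ht : ((weight a t)%:R <=
           19 / 10 * ((2 ^+ (d - 1) - w%:R) / (d%:R * log2 (d%:R : R))))%R) :
  exists C : circuit V,
    realizes C (fun x => extended_and_or_path (map x s) (map x t)) /\
    delay C a <= d.
Proof.
have t0 : tval t != [::] by rewrite -size_eq0 size_tuple -lt0n.
apply: (circuit_of_cost (ltnW hd) t0); rewrite hs.
exact: cost_le_of_weight ht.
Qed.
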